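(* For each $n$ let $X=X(n)$ be a random covering variable for an $n$-set $V=V(n)$, with $q_x=\mathbb{P}(x\in X)$ and $q_{xy}=\mathbb{P}(x,y\in X)$, and let $T(\mathbf{X})$ be the covering time of the $X$-coupon collector. For real $t\ge 0$ write $\mathbb{E}Z_t=\sum_{x\in V}e^{-q_xt}$. Suppose there exist $C=C(n)\ge 0$, $T^-=T^-(n)\geq 0$ and $T^+=T^+(n)\geq 0$ such that all of the following hold: (i) $\mathbb{E}Z_{T^-}\to\infty$ and $\mathbb{E}Z_{T^+}\to 0$ as $n\to\infty$; (ii) $q_{xy}\le C\,q_xq_y$ for all $x\ne y$ in $V$; (iii) $C\bar q=o\left(\frac{1}{\log n}\right)$, where $$\bar q=\mathbb{E}\big[q_\theta\,\big|\,\theta\text{ not covered at time }T^-\big]=\frac{\sum_{x\in V}q_xe^{-q_xT^-}}{\sum_{x\in V}e^{-q_xT^-}}.$$ Then $T^-\le T(\mathbf{X})\le T^+$ with high probability.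
   Context: A random covering variable (random coupon) for a finite set $V$ is a random variable $X$ with values in the power set of $V$. The $X$-coupon collector receives i.i.d. coupons $\mathbf{X}=(X_1,X_2,\dots)$ with $X_i\sim X$; $C_t=\bigcup_{i\le t}X_i$; the covering time is $T=T(\mathbf{X})=\inf\{t\in\mathbb{Z}_{\ge0}:C_t=V\}$ (infinite if there is no such $t$). With high probability (whp) means with probability tending to $1$ as $n\to\infty$. $Z_t$ denotes the number of elements of $V$ not covered by real time $t$ in the continuous-time version of the process, in which i.i.d. copies of $X$ are received at the points of a rate-$1$ Poisson process on $[0,\infty)$; an element $x$ is then uncovered at time $t$ with probability $e^{-q_xt}$. In the definition of $\bar q$, ''not covered at time $T^-$'' refers to this continuous-time process, and $\theta$ is a uniformly random element of $V$ independent of the process. *)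

(* Defs.v *)
From HB Require Import structures.
From mathcomp Require Import all_boot all_order all_algebra.
From mathcomp Require Import all_classical all_reals all_analysis.

Set Implicit Arguments.
Unset Strict Implicit.
Unset Printing Implicit Defensive.

Import Order.TTheory GRing.Theory Num.Theory.
Import numFieldNormedType.Exports.
Local Open Scope classical_set_scope.
Local Open Scope ring_scope.

HB.instance Definition _ (V : finType) := isPointed.Build {set V} finset.set0.

(* The discrete sigma-algebra, as the library does for [bool] and [nat]. *)
HB.instance Definition _ (V : finType) :=
  @isMeasurable.Build default_measure_display {set V} discrete_measurable
    discrete_measurable0 discrete_measurableC discrete_measurableU.

Section independence.
Context {d d' : measure_display} {Omega : measurableType d}
  {S : measurableType d'} {R : realType}.

(* Mutual independence: the product rule over every finite subfamily. *)
Definition independent_seq (P : probability Omega R)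
    (X : nat -> {RV P >-> S}) :=
  forall (J : seq nat) (A : nat -> set S), uniq J ->
    (forall i, measurable (A i)) ->
    P (\bigcap_(i in [set` J]) (X i @^-1` A i)) =
    (\prod_(i <- J) P (X i @^-1` A i))%E.

End independence.

Section coupons.
Context {R : realType} {V : finType}.

Definition cover_prob {d} {Omega : measurableType d}
    (P : probability Omega R) (X : {RV P >-> {set V}}) (x : V) : R :=
  fine (P [set w | x \in X w]).

Definition cover_prob2 {d} {Omega : measurableType d}
    (P : probability Omega R) (X : {RV P >-> {set V}}) (x y : V) : R :=
  fine (P [set w | (x \in X w) && (y \in X w)]).

(* [Xs] is a sequence of i.i.d. copies of [X]; the copies may live on a
   probability space other than that of [X]. *)
Definition iid_copies {d d'} {Omega : measurableType d}
    {Omega' : measurableType d'} (P : probability Omega R)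
    (P' : probability Omega' R) (X : {RV P >-> {set V}})
    (Xs : nat -> {RV P' >-> {set V}}) :=
  independent_seq Xs /\
  forall i (A : set {set V}), distribution P' (Xs i) A = distribution P X A.

Section covering_time.
Context {d : measure_display} {Omega : measurableType d}
  {P : probability Omega R}.

(* [Xs i] is the (i+1)-st coupon, so this is the union of the first [t]. *)
Definition collected (Xs : nat -> {RV P >-> {set V}}) (t : nat) (w : Omega)
  : {set V} := (\bigcup_(i < t) Xs i w)%SET.

(* The infimum of the empty set is +oo. *)
Definition covering_time (Xs : nat -> {RV P >-> {set V}}) (w : Omega)
  : \bar R :=
  ereal_inf [set (t%:R)%:E | t in [set t | collected Xs t w = finset.setT]].

End covering_time.

(* In the rate-1 continuous-time collector, x is uncovered at time t with
   probability exp(- q x * t); hence the expected number of uncovered elements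
   is the following sum. *)
Definition expected_uncovered (q : V -> R) (t : R) : R :=
  \sum_(x : V) expR (- (q x * t)).

(* E[q theta | theta uncovered at time t], for theta uniform on V and
   independent of the process. *)
Definition mean_uncovered (q : V -> R) (t : R) : R :=
  (\sum_(x : V) q x * expR (- (q x * t))) / expected_uncovered q t.

End coupons.

(* Main.v *)
Require Import Defs.
From mathcomp Require Import all_boot all_order all_algebra.
From mathcomp Require Import all_classical all_reals all_analysis.
From mathcomp Require Import ring lra.
Import Order.TTheory GRing.Theory Num.Theory.
Import numFieldNormedType.Exports.
Local Open Scope classical_set_scope.
Local Open Scope ring_scope.

(* The upper bound is the union bound at time floor(T^+), where rounding costs a
   factor of at most e.  For the lower bound, let m be the largest integer
   below T^- and apply Chebyshev's inequality, directly in discrete time, to the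
   number of uncovered elements of W = {x : max(C,1) q_x^2 T^- <= eps}.  For x, y
   in W the probability (1 - q_x - q_y + q_xy)^m that both are uncovered is at
   most e^(5 eps) (1 - q_x)^m (1 - q_y)^m, and (1 - q_x)^m is comparable with
   e^(-q_x T^-), so it remains to see that the elements outside W contribute only
   a small part of E Z_(T^-).  For C > 1/2 this follows from C qbar = o(1/log n);
   a smaller C makes it possible that the hypothesis on qbar carries no
   information, but then the pair condition itself forces sum_x q_x <= 2. *)

(** * Exponential estimates and second moments *)

(** For q <= 1/2 one has (1 - q)(1 + q + 2 q^2) >= 1, hence 1 - q >= e^(-q - 2 q^2). The bound m q^2
    <= 1/4 forces q <= 1/2 once m >= 1; the case m = 0 is separate. *)
Lemma one_sub_exp_ge {R : realType} (q e : R) (m : nat) :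
  0 <= q <= 1 -> m%:R * q ^+ 2 <= e -> e <= 1 / 4 ->
  expR (- (m%:R * q + 2 * e)) <= (1 - q) ^+ m.
Proof.
case: m => [|m] q01 he e4.
  move: he; rewrite expr0 !mulr0n !mul0r => he.
  by rewrite -[leRHS]expR0 ler_expR; lra.
have q2 : q <= 1 / 2.
  have : q ^+ 2 <= m.+1%:R * q ^+ 2.
    by rewrite ler_peMl ?sqr_ge0 // ler1n.
  nra.
have h : expR (- (q + 2 * q ^+ 2)) <= 1 - q.
  rewrite expRN invf_ple ?posrE ?expR_gt0 //; last lra.
  apply: le_trans (expR_ge1Dx _).
  rewrite -[leLHS]mul1r ler_pdivrMr; last lra.
  nra.
apply: (@le_trans _ _ (expR (- (q + 2 * q ^+ 2)) ^+ m.+1)).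
  rewrite -expRM_natl ler_expR; lra.
by rewrite lerXn2r ?nnegrE ?expR_ge0 //; lra.
Qed.

Lemma expr_le_exp {R : realType} (a b : R) (m : nat) :
  0 <= a <= 1 + b -> a ^+ m <= expR (m%:R * b).
Proof.
move=> /andP[a0 ab]; rewrite expRM_natl lerXn2r ?nnegrE ?expR_ge0 //.
exact: le_trans ab (expR_ge1Dx _).
Qed.

(** The exponent 5 e is made up of e for the correlation term m D q1 q2 and 2 e for each factor (1 -
    q_i)^m, bounded below by an exponential. *)
Lemma pair_uncovered_le {R : realType} (q1 q2 q12 D e : R) (m : nat) :
  0 <= q1 <= 1 -> 0 <= q2 <= 1 -> 0 <= 1 - q1 - q2 + q12 ->
  q12 <= D * (q1 * q2) ->
  m%:R * q1 ^+ 2 <= e -> m%:R * q2 ^+ 2 <= e ->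
  m%:R * (D * (q1 * q2)) <= e -> e <= 1 / 4 ->
  (1 - q1 - q2 + q12) ^+ m <= expR (5 * e) * ((1 - q1) ^+ m * (1 - q2) ^+ m).
Proof.
move=> q1P q2P q0 qD e1 e2 e12 e4.
apply: (@le_trans _ _ (expR (m%:R * (D * (q1 * q2) - q1 - q2)))).
  by apply: expr_le_exp; lra.
have m1 := one_sub_exp_ge q1 e m q1P e1 e4.
have m2 := one_sub_exp_ge q2 e m q2P e2 e4.
apply: (@le_trans _ _ (expR (5 * e) *
   (expR (- (m%:R * q1 + 2 * e)) * expR (- (m%:R * q2 + 2 * e))))).
  by rewrite -!expRD ler_expR; lra.
by rewrite ler_pM2l ?expR_gt0 // ler_pM ?expR_ge0.
Qed.

Lemma expR_sub1_le {R : realType} (y : R) :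
  0 <= y <= 3 / 4 -> expR y - 1 <= 4 * y.
Proof.
move=> yP.
have : expR y <= (1 - y)^-1.
  rewrite -[expR y]invrK -expRN lef_pV2 ?posrE ?expR_gt0 //; last lra.
  exact: expR_ge1Dx.
have : (1 - y)^-1 - 1 <= 4 * y; last lra.
rewrite lerBlDr -[leLHS]mul1r ler_pdivrMr; last lra.
nra.
Qed.

Lemma uncovered_floor_le {R : realType} (q t : R) (k : nat) :
  0 <= q <= 1 -> t < k.+1%:R ->
  (1 - q) ^+ k <= expR 1 * expR (- (q * t)).
Proof.
move=> qP tk; apply: (@le_trans _ _ (expR (k%:R * - q))).
  by apply: expr_le_exp; lra.
rewrite -expRD ler_expR; move: tk; rewrite -natr1; nra.
Qed.

(** [f] is a probability law on finitely many outcomes, and the indicators [r x] count elements of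
    [A]. In the second moment the diagonal gives mu, as indicators are idempotent, and the other
    pairs give at most K mu^2. Used for uncovered elements with K near 1, and for the size of a
    single coupon with K = C. *)
Lemma variance_count_le {R : realFieldType} {T V : finType}
    (f : T -> R) (r : V -> T -> bool) (A : pred V) (K : R)
    (mu := \sum_(x | A x) \sum_(w | r x w) f w) :
  (forall w, 0 <= f w) -> \sum_w f w = 1 ->
  (forall x y, A x -> A y -> x != y ->
    \sum_(w | r x w && r y w) f w <=
      K * ((\sum_(w | r x w) f w) * \sum_(w | r y w) f w)) ->
  0 <= K ->
  \sum_w f w * (\sum_(x | A x) (r x w)%:R - mu) ^+ 2 <=
    mu + (K - 1) * mu ^+ 2.
Proof.
move=> f0 f1 pairs K0; pose N w : R := \sum_(x | A x) (r x w)%:R.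
have meanN : \sum_w f w * N w = mu.
  under eq_bigr do rewrite mulr_sumr.
  rewrite exchange_big /=; apply: eq_bigr => x _.
  by rewrite [RHS]big_mkcond; apply: eq_bigr => w _; case: (r x w);
    rewrite ?mulr1 ?mulr0.
have sqN : \sum_w f w * N w ^+ 2 =
    \sum_(x | A x) \sum_(y | A y) \sum_(w | r x w && r y w) f w.
  transitivity (\sum_w \sum_(x | A x) \sum_(y | A y)
      f w * ((r x w)%:R * (r y w)%:R)).
    apply: eq_bigr => w _; rewrite expr2 {1}/N mulr_suml mulr_sumr.
    by apply: eq_bigr => x _; rewrite mulr_sumr mulr_sumr.
  rewrite exchange_big; apply: eq_bigr => x _ /=.
  rewrite exchange_big; apply: eq_bigr => y _ /=.
  by rewrite [RHS]big_mkcond; apply: eq_bigr => w _; rewrite -natrM mulnb;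
    case: (_ && _); rewrite ?mulr1 ?mulr0.
have -> : \sum_w f w * (N w - mu) ^+ 2 = \sum_w f w * N w ^+ 2 - mu ^+ 2.
  transitivity (\sum_w (f w * N w ^+ 2 - 2 * mu * (f w * N w) + mu ^+ 2 * f w)).
    by apply: eq_bigr => w _; ring.
  by rewrite !big_split /= sumrN -!mulr_sumr meanN f1; ring.
suff : \sum_w f w * N w ^+ 2 <= mu + K * mu ^+ 2 by lra.
rewrite sqN; pose m x := \sum_(w | r x w) f w.
have m0 x : 0 <= m x by apply: sumr_ge0.
have -> : mu + K * mu ^+ 2 = \sum_(x | A x) (m x + K * (m x * mu)).
  by rewrite big_split /= -mulr_sumr -mulr_suml -expr2.
apply: ler_sum => x Ax; rewrite (bigD1 x) //=.
under eq_bigl do rewrite andbb.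
rewrite -/(m x) lerD2l [mu](bigD1 x) //= mulrDr mulrDr.
(* The diagonal part K m(x)^2 of K m(x) mu is nonnegative and is given away. *)
rewrite -[leLHS]add0r lerD //; first by rewrite mulr_ge0 ?(mulr_ge0 (m0 x) (m0 x)).
rewrite [m x * _]mulr_sumr mulr_sumr.
by apply: ler_sum => y /andP[Ay yx]; apply: pairs; rewrite // eq_sym.
Qed.

(** The single outcome [w0], where the count is 0, already contributes f(w0) mu^2 to the
    variance. *)
Lemma chebyshev_count0 {R : realFieldType} {T V : finType}
    (f : T -> R) (r : V -> T -> bool) (A : pred V) (K : R) (w0 : T)
    (mu := \sum_(x | A x) \sum_(w | r x w) f w) :
  (forall w, 0 <= f w) -> \sum_w f w = 1 ->
  (forall x y, A x -> A y -> x != y ->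
    \sum_(w | r x w && r y w) f w <=
      K * ((\sum_(w | r x w) f w) * \sum_(w | r y w) f w)) ->
  0 <= K -> (forall x, A x -> ~~ r x w0) ->
  f w0 * mu ^+ 2 <= mu + (K - 1) * mu ^+ 2.
Proof.
move=> f0 f1 pairs K0 rw0.
apply: le_trans (variance_count_le f r A K f0 f1 pairs K0).
rewrite -/mu (bigD1 w0) //= big1 => [|x Ax]; last by rewrite (negbTE (rw0 x Ax)).
rewrite sub0r sqrrN lerDl; apply: sumr_ge0 => w _.
by rewrite mulr_ge0 ?sqr_ge0.
Qed.

(* Strong negative correlation forces a bounded expected count [mu]: the variance
   bound leaves [0 <= mu - mu ^+ 2 / 2]. *)
Lemma sum_inclusion_le2 {R : realFieldType} {T V : finType}
    (f : T -> R) (r : V -> T -> bool) (C : R) :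
  (forall w, 0 <= f w) -> \sum_w f w = 1 ->
  (forall x y, x != y ->
    \sum_(w | r x w && r y w) f w <=
      C * ((\sum_(w | r x w) f w) * \sum_(w | r y w) f w)) ->
  0 <= C <= 1 / 2 -> \sum_x \sum_(w | r x w) f w <= 2.
Proof.
move=> f0 f1 pairs /andP[C0 C2].
have := variance_count_le f r predT C f0 f1 (fun x y _ _ => pairs x y) C0.
set mu := \sum_x _ => hv.
have mu0 : 0 <= mu by apply: sumr_ge0 => x _; apply: sumr_ge0.
have : 0 <= \sum_w f w * (\sum_x (r x w)%:R - mu) ^+ 2.
  by apply: sumr_ge0 => w _; rewrite mulr_ge0 ?sqr_ge0.
move=> /le_trans /(_ hv) h.
have : mu * (mu - 2) <= 0 by nra.
by move: mu0; rewrite le_eqVlt => /predU1P[<-|mu0]; [lra|rewrite pmulr_rle0//; lra].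
Qed.

(** * The lower tail *)

(* The terms removed from E Z are negligible for two different reasons.  If
   C > 1/2, either q t > ln n, so that the term is below 1/n, or q is large
   compared with the tilted mean of q, as in Markov's inequality.  If C <= 1/2,
   then sum q <= 2, and q^2 t > e makes the term at most 1 / (q t) < q / e. *)
Lemma atypical_sum_le {R : realType} {V : finType} (q : V -> R) (C t e : R) :
  (0 < #|V|)%N -> (forall x, 0 <= q x) -> 0 <= t -> 0 < e ->
  0 <= C -> (C <= 1 / 2 -> \sum_x q x <= 2) ->
  \sum_(x | e < Num.max C 1 * (q x ^+ 2 * t)) expR (- (q x * t)) <=
    1 + 2 / e +
    2 * C * ln #|V|%:R / e * \sum_x q x * expR (- (q x * t)).
Proof.
move=> V0 q0 t0 e0 C0 qsum; set L := ln _.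
have n0 : 0 < #|V|%:R :> R by rewrite ltr0n.
have L0 : 0 <= L by rewrite ln_ge0 // ler1n.
have [C2|C2] := leP C (1 / 2).
  have -> : Num.max C 1 = 1 by apply/max_idPr; lra.
  under eq_bigl do rewrite mul1r.
  apply: (@le_trans _ _ (\sum_x q x / e)).
    rewrite [leLHS]big_mkcond; apply: ler_sum => x _.
    case: ltP => [ex|_]; last by rewrite divr_ge0 // ltW.
    rewrite ler_pdivlMr //.
    have := expR_ge1Dx (q x * t); rewrite expRN => h.
    have qt : 0 <= q x * t by rewrite mulr_ge0.
    rewrite ler_pdivrMl ?expR_gt0 //.
    apply: (@le_trans _ _ ((q x * t) * q x)); first by nra.
    by rewrite ler_wpM2r //; lra.
  rewrite -mulr_suml.
  have : (\sum_x q x) / e <= 2 / e by rewrite ler_pM2r ?invr_gt0 // qsum.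
  have : 0 <= 2 * C * L / e * \sum_x q x * expR (- (q x * t)).
    rewrite mulr_ge0 ?divr_ge0 ?mulr_ge0 ?(ltW e0) //.
    by apply: sumr_ge0 => x _; rewrite mulr_ge0 ?expR_ge0.
  lra.
have D2 : Num.max C 1 <= 2 * C by rewrite ge_max; apply/andP; split; lra.
apply: (@le_trans _ _
  (\sum_x (#|V|%:R^-1 + 2 * C * L / e * (q x * expR (- (q x * t)))))).
  rewrite [leLHS]big_mkcond; apply: ler_sum => x _.
  have c0 : 0 <= 2 * C * L / e * (q x * expR (- (q x * t))).
    by rewrite mulr_ge0 ?divr_ge0 ?mulr_ge0 ?(ltW e0) ?expR_ge0.
  have n1 : 0 < #|V|%:R^-1 :> R by rewrite invr_gt0.
  case: ltP => [ex|_]; last by lra.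
  have [qL|qL] := leP (q x * t) L.
    (* Here e < 2 C q^2 t <= 2 C q L, so the weight 2 C L q / e is at least 1. *)
    suff : expR (- (q x * t)) <= 2 * C * L / e * (q x * expR (- (q x * t))) by lra.
    rewrite mulrA ler_peMl ?expR_ge0 // mulrAC ler_pdivlMr // mul1r.
    apply: le_trans (ltW ex) _.
    apply: (@le_trans _ _ (2 * C * (q x ^+ 2 * t))).
      by rewrite ler_wpM2r // mulr_ge0 ?sqr_ge0.
    have : 0 <= 2 * C * q x by rewrite !mulr_ge0.
    move=> /ler_wpM2l /(_ _ _ qL); lra.
  suff : expR (- (q x * t)) <= #|V|%:R^-1 by lra.
  rewrite -[X in _ <= X^-1]lnK ?posrE // -expRN ler_expR lerN2; exact: ltW.
rewrite big_split /= sumr_const -mulr_sumr -[_ *+ _]mulr_natl divff ?gt_eqF //.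
have : 0 < 2 / e by rewrite divr_gt0.
lra.
Qed.

(** [f] stands for the law of the set collected after [m] coupons, so [f [set: V]] is the
    probability that covering is complete by then. Chebyshev bounds it by 1/mu + (K - 1), where mu
    is the expected number of uncovered elements of [W] and K = e^(5e); here mu >= Z/4 and K - 1 <=
    20 e. *)
Lemma early_cover_le {R : realType} {V : finType} (f : {set V} -> R)
    (q : V -> R) (q2 : V -> V -> R) (C t e : R) (m : nat) :
  (0 < #|V|)%N -> (forall B, 0 <= f B) -> \sum_B f B = 1 ->
  (forall x, \sum_(B : {set V} | x \notin B) f B = (1 - q x) ^+ m) ->
  (forall x y, \sum_(B : {set V} | (x \notin B) && (y \notin B)) f B =
     (1 - q x - q y + q2 x y) ^+ m) ->
  (forall x, 0 <= q x <= 1) -> (forall x y, 0 <= 1 - q x - q y + q2 x y) ->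
  (forall x y, x != y -> q2 x y <= C * (q x * q y)) ->
  (C <= 1 / 2 -> \sum_x q x <= 2) -> 0 <= C -> m%:R <= t ->
  0 < e <= 1 / 8 -> C * mean_uncovered q t * ln #|V|%:R <= e / 8 ->
  1 + 2 / e <= expected_uncovered q t / 4 ->
  f [set: V]%SET <= 4 / expected_uncovered q t + 20 * e.
Proof.
move=> V0 f0 f1 p1 p2 q01 q20 pairs qsum C0 mt /andP[e0 e8] small large.
set Z := expected_uncovered q t in large *; set D := Num.max C 1.
have t0 : 0 <= t by apply: le_trans mt.
have q0 x : 0 <= q x by case/andP: (q01 x).
have CD : C <= D by rewrite le_max lexx.
have D1 : 1 <= D by rewrite le_max lexx orbT.
have e0' : 0 < 2 / e by rewrite divr_gt0.
have Z0 : 0 < Z by lra.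
(* D >= 1 makes m q_x^2 <= e on [W], and D >= C makes m C q_x q_y <= e for pairs in [W]. *)
pose W := [pred x | D * (q x ^+ 2 * t) <= e].
have Wm x : W x -> m%:R * q x ^+ 2 <= e.
  move=> /= /(le_trans _); apply; apply: (@le_trans _ _ (q x ^+ 2 * t)).
    by rewrite mulrC ler_wpM2l // sqr_ge0.
  by rewrite ler_peMl // mulr_ge0 // sqr_ge0.
have Wp x : W x -> expR (- (2 * e)) * expR (- (q x * t)) <= (1 - q x) ^+ m.
  move=> Wx.
  apply: le_trans (one_sub_exp_ge (q x) e m (q01 x) (Wm x Wx) _); last lra.
  rewrite -expRD ler_expR; have := ler_wpM2r (q0 x) mt; lra.
(* Outside [W] the sum is at most (1 + 2/e) + (2/e)(e/8) Z <= Z/4 + Z/4. *)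
have WZ : Z / 2 <= \sum_(x | W x) expR (- (q x * t)).
  have := atypical_sum_le q C t e V0 q0 t0 e0 C0 qsum.
  have -> : 2 * C * ln #|V|%:R / e * \sum_x q x * expR (- (q x * t)) =
      2 / e * (C * mean_uncovered q t * ln #|V|%:R) * Z.
    rewrite /mean_uncovered -/Z; field.
    by rewrite !gt_eqF.
  have := ler_wpM2r (ltW Z0) (ler_wpM2l (ltW e0') small).
  have -> : 2 / e * (e / 8) * Z = Z / 4 by field; rewrite gt_eqF.
  have : Z = \sum_(x | W x) expR (- (q x * t)) +
      \sum_(x | e < D * (q x ^+ 2 * t)) expR (- (q x * t)).
    rewrite /Z /expected_uncovered (bigID W) /=.
    by under [X in _ + X = _]eq_bigl do rewrite -ltNge.
  rewrite -/D.
  lra.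
pose mu := \sum_(x | W x) \sum_(B : {set V} | x \notin B) f B.
(* Passing from e^(-q t) to (1 - q)^m costs a further factor e^(-2e) >= 1/2. *)
have muZ : Z / 4 <= mu.
  apply: (@le_trans _ _ (\sum_(x | W x) expR (- (2 * e)) * expR (- (q x * t)))).
    rewrite -mulr_sumr.
    have h : 1 / 2 <= expR (- (2 * e)).
      by apply: le_trans (expR_ge1Dx _); lra.
    have Z2 : 0 <= Z / 2 by lra.
    have := ler_pM _ Z2 h WZ; lra.
  by apply: ler_sum => x Wx; rewrite p1 Wp.
have K1 : expR (5 * e) - 1 <= 20 * e.
  by have := @expR_sub1_le R (5 * e); lra.
have : f [set: V]%SET * mu ^+ 2 <= mu + (expR (5 * e) - 1) * mu ^+ 2.
  apply: (chebyshev_count0 f (fun x (B : {set V}) => x \notin B)) => //.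
  - move=> x y Wx Wy xy; rewrite p2 !p1.
    apply: (pair_uncovered_le _ _ _ C) => //; rewrite ?Wm ?pairs //; last lra.
    have h : m%:R * (C * (q x * q y)) <= t * (D * (q x * q y)).
      by rewrite ler_pM ?ler_wpM2r ?mulr_ge0.
    apply: le_trans h _.
    move: Wx Wy => /= Wx Wy.
    (* By 2 q_x q_y <= q_x^2 + q_y^2, D t q_x q_y is at most the mean of two quantities bounded by
       e. *)
    have : 0 <= (D * t) * (q x - q y) ^+ 2.
      by rewrite mulr_ge0 ?sqr_ge0 // mulr_ge0 //; lra.
    lra.
  - by move=> x _; rewrite inE.
have mu0 : 0 < mu by lra.
rewrite -ler_pdivlMr ?exprn_gt0 // => /le_trans; apply.
rewrite mulrDl mulfK ?expf_neq0 ?gt_eqF // lerD //.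
have -> : mu / mu ^+ 2 = mu^-1 by field; rewrite gt_eqF.
by rewrite -[4 / Z]invf_div lef_pV2 ?posrE //; lra.
Qed.

(** * Laws of the collected sets *)

Lemma finite_preimage_cover {Omega : Type} {T : finType} (Y : Omega -> T)
    (A : pred T) :
  [set w | A (Y w)] = \bigcup_(b in [set` A]) [set w | Y w = b].
Proof.
by apply/seteqP; split=> w /= => [Aw|[b Ab /= ->]] //; exists (Y w).
Qed.

Lemma measurable_finite_preimage {d} {Omega : measurableType d} {T : finType}
    (Y : Omega -> T) (A : pred T) :
  (forall b, measurable [set w | Y w = b]) -> measurable [set w | A (Y w)].
Proof.
move=> mY; rewrite finite_preimage_cover.
by apply: fin_bigcup_measurable => //; exact: finite_finpred.
Qed.

(** Turns probabilities into finite sums over values, the form in which the second-moment bounds are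
    stated. *)
Lemma prob_finite_preimage {d} {Omega : measurableType d} {R : realType}
    (P : probability Omega R) {T : finType} (Y : Omega -> T) (A : pred T) :
  (forall b, measurable [set w | Y w = b]) ->
  fine (P [set w | A (Y w)]) = \sum_(b | A b) fine (P [set w | Y w = b]).
Proof.
move=> mY; have triv : trivIset [set` A] (fun b => [set w | Y w = b]).
  by move=> b b' _ _ [w [/= <- <-]].
rewrite finite_preimage_cover measure_fin_bigcup //.
rewrite -(@bigfs _ _ _ _ (index_enum T)) ?index_enum_uniq //; last first.
  by move=> b _; rewrite mem_index_enum.
by rewrite -sum_fine // => b _; exact: fin_num_measure.
Qed.

Lemma prob_bernoulli_trials {R : realType} {V : finType} {d d'}
    {Omega : measurableType d} {Omega' : measurableType d'}
    (P : probability Omega R) (P' : probability Omega' R)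
    (X : {RV P >-> {set V}}) (Xs : nat -> {RV P' >-> {set V}})
    (A : pred {set V}) (t : nat) :
  iid_copies X Xs ->
  fine (P' [set w | forall i, (i < t)%N -> A (Xs i w)]) =
    fine (P [set w | A (X w)]) ^+ t.
Proof.
move=> [ind same].
have -> : [set w | forall i, (i < t)%N -> A (Xs i w)] =
    \bigcap_(i in [set` iota 0 t]) (Xs i @^-1` [set` A]).
  by apply/seteqP; split=> w h i /=; have := h i; rewrite /= mem_iota.
rewrite (ind (iota 0 t) (fun=> [set` A])) ?iota_uniq //.
rewrite (eq_bigr (fun=> P [set w | A (X w)])); last first.
  by move=> i _; exact: (same i [set` A]).
have mA : measurable (X @^-1` [set` A]) by apply: measurable_funPTI.
have /fineK <- : P [set w | A (X w)] \is a fin_num := fin_num_measure P _ mA.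
by rewrite prodEFin big_const_seq count_predT size_iota iter_mulr_1.
Qed.

(** A fibre is a finite intersection of events fixing whether x has been collected, and collecting x
    is a union of coupon events. *)
Lemma measurable_collected {R : realType} {V : finType} {d}
    {Omega : measurableType d} {P : probability Omega R}
    (Xs : nat -> {RV P >-> {set V}}) (t : nat) (B : {set V}) :
  measurable [set w | collected Xs t w = B].
Proof.
have mx x : measurable [set w | x \in collected Xs t w].
  have -> : [set w | x \in collected Xs t w] =
      \bigcup_(i in `I_t) (Xs i @^-1` [set S : {set V} | x \in S]).
    apply/seteqP; split=> w /=.
      by move=> /finset.bigcupP[i _ xi]; exists (i : nat) => /=.
    by move=> [i /= it xi]; apply/finset.bigcupP; exists (Ordinal it).
  by apply: bigcup_measurable => i _; apply: measurable_funPTI.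
have -> : [set w | collected Xs t w = B] =
    \bigcap_(x in [set: V]) [set w | (x \in collected Xs t w) = (x \in B)].
  apply/seteqP; split=> w /=.
    by move=> <- x.
  by move=> h; apply/setP => x; exact: (h x).
apply: fin_bigcap_measurable => // x _; case: (x \in B); first exact: mx.
rewrite (_ : [set w | _] = ~` [set w | x \in collected Xs t w]).
  by apply: measurableC.
by apply/seteqP; split=> w /= => [/negbT/negP|/negP/negbTE].
Qed.

Lemma notin_collected {R : realType} {V : finType} {d}
    {Omega : measurableType d} {P : probability Omega R}
    (Xs : nat -> {RV P >-> {set V}}) (t : nat) (w : Omega) (x : V) :
  (x \notin collected Xs t w) <-> (forall i, (i < t)%N -> x \notin Xs i w).
Proof.
split=> [/finset.bigcupP h i it|h].
  by apply/negP => xi; apply: h; exists (Ordinal it).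
by apply/finset.bigcupP => -[i _]; apply/negP; exact: h.
Qed.

Lemma collected_mono {R : realType} {V : finType} {d}
    {Omega : measurableType d} {P : probability Omega R}
    (Xs : nat -> {RV P >-> {set V}}) (s t : nat) (w : Omega) :
  (s <= t)%N -> collected Xs s w = [set: V]%SET ->
  collected Xs t w = [set: V]%SET.
Proof.
move=> st full; apply/eqP; rewrite -finset.subTset -full.
apply/fintype.subsetP => x /finset.bigcupP[i _ xi]; apply/finset.bigcupP.
by exists (widen_ord st i).
Qed.

(** The covering time is a natural number or +oo, so only the state at [m], the last integer below
    a, and at [k], the floor of b, matters. The second alternative serves a = 0, where no natural
    number lies below a. *)
Lemma covering_time_between {R : realType} {V : finType} {d}
    {Omega : measurableType d} {P : probability Omega R}
    (Xs : nat -> {RV P >-> {set V}}) (a b : R) (m k : nat) :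
  (m%:R < a \/ m = 0%N /\ (0 < #|V|)%N) -> a <= m.+1%:R ->
  k%:R <= b < k.+1%:R ->
  [set w | (a%:E <= covering_time Xs w)%E /\ (covering_time Xs w <= b%:E)%E] =
  [set w | collected Xs k w = [set: V]%SET] `&`
    ~` [set w | collected Xs m w = [set: V]%SET].
Proof.
move=> ma am /andP[kb bk]; apply/seteqP; split=> w /=.
  move=> [aT Tb]; split; last first.
    move=> full; case: ma => [ma|[m0 V0]].
      have : (covering_time Xs w <= m%:R%:E)%E.
        by apply: ereal_inf_lbound; exists m.
      by move=> /(le_trans aT); rewrite lee_fin leNgt ma.
    (* At time 0 the collected set is empty, while [V] is not. *)
    move: full; rewrite m0 /collected big_ord0 => /esym/eqP.
    by rewrite -cards_eq0 cardsT -leqn0 leqNgt V0.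
  apply: contrapT => nfull.
  have : (k.+1%:R%:E <= covering_time Xs w)%E.
    apply: le_ereal_inf_tmp => _ [t /= ft <-]; rewrite lee_fin ler_nat ltnNge.
    by apply/negP => tk; apply: nfull; apply: collected_mono ft.
  by move=> /le_trans /(_ Tb); rewrite lee_fin leNgt bk.
move=> [fk fm]; split.
  apply: le_ereal_inf_tmp => _ [t /= ft <-]; rewrite lee_fin.
  apply: le_trans am _; rewrite ler_nat ltnNge.
  by apply/negP => tm; apply: fm; apply: collected_mono ft.
apply: (@le_trans _ _ k%:R%:E); last by rewrite lee_fin.
by apply: ereal_inf_lbound; exists k.
Qed.

(** The union bound: a set other than V misses some x, so its mass occurs in at least one inner
    sum. *)
Lemma sum_not_full_le {R : realFieldType} {V : finType} (f : {set V} -> R) :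
  (forall B, 0 <= f B) ->
  \sum_(B | B != [set: V]%SET) f B <=
    \sum_x \sum_(B : {set V} | x \notin B) f B.
Proof.
move=> f0; under [leRHS]eq_bigr do rewrite big_mkcond.
rewrite exchange_big [leLHS]big_mkcond; apply: ler_sum => B _ /=.
have s0 (A : pred V) : 0 <= \sum_(x | A x) (if x \notin B then f B else 0).
  by apply: sumr_ge0 => x _; case: ifP.
case: ifP => // BT; have [x xB] : exists x, x \notin B.
  apply/existsP; rewrite -negb_forall; apply: contra BT => /forallP h.
  by apply/eqP/setP => x; rewrite inE h.
by rewrite (bigD1 x) //= xB lerDl.
Qed.

(** * From the law of one coupon to explicit bounds for a fixed collector *)

Section coupon_laws.
Context {R : realType} {V : finType} {d d' : measure_display}
  {Omega : measurableType d} {Omega' : measurableType d'}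
  {P : probability Omega R} {P' : probability Omega' R}
  {X : {RV P >-> {set V}}} {Xs : nat -> {RV P' >-> {set V}}}.

Let law (B : {set V}) : R := fine (P [set w | X w = B]).

Lemma measurable_coupon B : measurable [set w | X w = B].
Proof.
by rewrite (_ : [set w | _] = X @^-1` [set B]) //; apply: measurable_funPTI.
Qed.

Lemma prob_coupon (A : pred {set V}) :
  fine (P [set w | A (X w)]) = \sum_(B | A B) law B.
Proof. exact: prob_finite_preimage measurable_coupon. Qed.

Lemma law_ge0 B : 0 <= law B.
Proof. exact: fine_ge0. Qed.

Lemma law_sum1 : \sum_B law B = 1.
Proof.
rewrite -(prob_coupon predT).
by rewrite (_ : [set w | _] = setT) ?probability_setT //; apply/seteqP.
Qed.

Lemma cover_probE x : cover_prob X x = \sum_(B : {set V} | x \in B) law B.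
Proof. exact: (prob_coupon (fun B => x \in B)). Qed.

Lemma cover_prob2E x y :
  cover_prob2 X x y = \sum_(B : {set V} | (x \in B) && (y \in B)) law B.
Proof. exact: (prob_coupon (fun B => (x \in B) && (y \in B))). Qed.

Lemma prob_miss x :
  fine (P [set w | x \notin X w]) = 1 - cover_prob X x.
Proof.
rewrite (prob_coupon (fun B => x \notin B)) cover_probE.
by move: law_sum1; rewrite (bigID (fun B : {set V} => x \in B)) /= => <-; ring.
Qed.

Lemma prob_miss2 x y :
  fine (P [set w | (x \notin X w) && (y \notin X w)]) =
    1 - cover_prob X x - cover_prob X y + cover_prob2 X x y.
Proof.
rewrite (prob_coupon (fun B => (x \notin B) && (y \notin B))).
(* Inclusion-exclusion in subtraction-free form, which then holds separately for each set B. *)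
suff : \sum_(B : {set V} | (x \notin B) && (y \notin B)) law B +
    cover_prob X x + cover_prob X y = \sum_B law B + cover_prob2 X x y.
  by rewrite law_sum1; lra.
rewrite !cover_probE cover_prob2E.
rewrite [X in X + _ + _]big_mkcond [X in _ + X + _]big_mkcond.
rewrite [X in _ + X = _]big_mkcond [X in _ = _ + X]big_mkcond /=.
rewrite -!big_split; apply: eq_bigr => B _ /=.
by case: (x \in B); case: (y \in B) => /=; ring.
Qed.

Lemma cover_prob01 x : 0 <= cover_prob X x <= 1.
Proof.
apply/andP; split; first exact: fine_ge0.
by rewrite -subr_ge0 -prob_miss; exact: fine_ge0.
Qed.

Hypothesis iid : iid_copies X Xs.

Lemma sum_miss t x :
  \sum_(B : {set V} | x \notin B) fine (P' [set w | collected Xs t w = B]) =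
    (1 - cover_prob X x) ^+ t.
Proof.
have := prob_finite_preimage P' (collected Xs t) (fun B : {set V} => x \notin B)
  (measurable_collected Xs t).
move=> <-; rewrite -prob_miss.
rewrite -(prob_bernoulli_trials P P' X Xs (fun B : {set V} => x \notin B)) //.
congr (fine (P' _)); apply/seteqP.
by split=> w /notin_collected.
Qed.

Lemma sum_miss2 t x y :
  \sum_(B : {set V} | (x \notin B) && (y \notin B))
      fine (P' [set w | collected Xs t w = B]) =
    (1 - cover_prob X x - cover_prob X y + cover_prob2 X x y) ^+ t.
Proof.
have := prob_finite_preimage P' (collected Xs t)
  (fun B : {set V} => (x \notin B) && (y \notin B)) (measurable_collected Xs t).
move=> <-; rewrite -prob_miss2.
rewrite -(prob_bernoulli_trials P P' X Xs
  (fun B : {set V} => (x \notin B) && (y \notin B))) //.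
congr (fine (P' _)); apply/seteqP; split=> w /=.
  by move=> /andP[/notin_collected hx /notin_collected hy] i it; rewrite hx ?hy.
by move=> h; apply/andP; split; apply/notin_collected => i /h /andP[].
Qed.


(** The quantitative statement for one collector: 4/Z + 20 e, with Z the expectation at a, bounds
    the probability of covering before a, and the last error term that of covering after b. *)
Lemma cover_between_ge (C a b e : R) :
  (0 < #|V|)%N -> 0 <= C -> 0 <= a -> 0 <= b ->
  (forall x y, x != y ->
     cover_prob2 X x y <= C * (cover_prob X x * cover_prob X y)) ->
  0 < e <= 1 / 8 ->
  C * mean_uncovered (cover_prob X) a * ln #|V|%:R <= e / 8 ->
  1 + 2 / e <= expected_uncovered (cover_prob X) a / 4 ->
  let good := [set w | (a%:E <= covering_time Xs w)%E /\
                       (covering_time Xs w <= b%:E)%E] in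
  P' good \is a fin_num /\
  1 - (4 / expected_uncovered (cover_prob X) a + 20 * e +
       expR 1 * expected_uncovered (cover_prob X) b) <= fine (P' good) <= 1.
Proof.
move=> V0 C0 a0 b0 pairs e01 small large good.
(* For a > 0, [m] is the largest natural number strictly below a; for a = 0 the truncated
   predecessor gives m = 0. *)
pose k := Num.trunc b; pose m := (`|Num.ceil a|%N).-1.
have kb : k%:R <= b < k.+1%:R by exact: truncn_itv.
have [ma am] : (m%:R < a \/ m = 0%N /\ (0 < #|V|)%N) /\ a <= m.+1%:R.
  have [a_gt0|a_le0] := ltP 0 a.
    have [c cE] : exists c, `|Num.ceil a|%N = c.+1.
      have : (0 < `|Num.ceil a|)%N by rewrite absz_gt0 gt_eqF ?ceil_gt0.
      by case: `|_|%N => // c _; exists c.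
    have cR : c.+1%:R = (Num.ceil a)%:~R :> R.
      by rewrite -cE natr_absz ger0_norm // ltW // ceil_gt0.
    have := ceil_itv a; rewrite /m cE /= intrB -cR -natr1; lra.
  have -> : m = 0%N by rewrite /m (_ : a = 0) ?ceil0 //; lra.
  by split; [right|lra].
have m_le : m%:R <= a by case: ma => [/ltW //|[-> _]].
pose full t := [set w | collected Xs t w = [set: V]%SET].
have mfull t : measurable (full t) by exact: measurable_collected.
have mfullC t : measurable (~` full t) by exact: measurableC.
have goodE : good = full k `&` ~` full m by exact: covering_time_between.
have mgood : measurable good by rewrite goodE; exact: measurableI.
have fin A : measurable A -> P' A \is a fin_num := fin_num_measure P' A.
split; first exact: fin.
have law0 t B : 0 <= fine (P' [set w | collected Xs t w = B]) by exact: fine_ge0.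
have law1 t : \sum_B fine (P' [set w | collected Xs t w = B]) = 1.
  rewrite -(prob_finite_preimage P' (collected Xs t) predT
    (measurable_collected Xs t)).
  by rewrite (_ : [set w | _] = setT) ?probability_setT //; apply/seteqP.
have early : fine (P' (full m)) <=
    4 / expected_uncovered (cover_prob X) a + 20 * e.
  apply: (early_cover_le _ _ (cover_prob2 X) C _ _ m V0 (law0 m) (law1 m)
    (sum_miss m) (sum_miss2 m) cover_prob01 _ pairs) => //.
    by move=> x y; rewrite -prob_miss2; exact: fine_ge0.
  (* The second-moment bound is applied here to the number of elements in one coupon, not to the
     uncovered set. *)
  move=> C2; under eq_bigr do rewrite cover_probE.
  apply: (sum_inclusion_le2 _ _ C law_ge0 law_sum1); last by rewrite C0.
  by move=> x y /pairs; rewrite !cover_probE cover_prob2E.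
have late : fine (P' (~` full k)) <=
    expR 1 * expected_uncovered (cover_prob X) b.
  have -> : ~` full k = [set w | collected Xs k w != [set: V]%SET].
    by apply/seteqP; split=> w /= /eqP.
  rewrite (prob_finite_preimage P' (collected Xs k) (fun B => B != [set: V]%SET)
    (measurable_collected Xs k)).
  apply: le_trans (sum_not_full_le _ (law0 k)) _.
  rewrite /expected_uncovered mulr_sumr; apply: ler_sum => x _.
  rewrite sum_miss; apply: uncovered_floor_le; first exact: cover_prob01.
  by case/andP: kb.
(* The good event, early completion and late completion together exhaust the space. *)
have cover : 1 <= fine (P' good) + (fine (P' (full m)) + fine (P' (~` full k))).
  rewrite -lee_fin !EFinD !fineK ?fin // -(probability_setT P').
  have := measureU2 P' mgood (measurableU _ _ (mfull m) (mfullC k)).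
  have -> : good `|` (full m `|` ~` full k) = setT.
    rewrite goodE; apply/seteqP; split=> // w _ /=.
    by have [fm|fm] := pselect (full m w); have [fk|fk] := pselect (full k w);
      tauto.
  move/le_trans; apply; rewrite leeD2l //.
  exact: measureU2.
apply/andP; split; first lra.
by rewrite -lee_fin fineK ?fin // probability_le1.
Qed.

End coupon_laws.

(** * Passage to the limit *)

Theorem theorem3p2 (R : realType)
  (V : nat -> finType) (cardV : forall n, #|V n| = n)
  (d : nat -> measure_display) (Omega : forall n, measurableType (d n))
  (P : forall n, probability (Omega n) R)
  (X : forall n, {RV (P n) >-> {set (V n)}})
  (d' : nat -> measure_display) (Omega' : forall n, measurableType (d' n))
  (P' : forall n, probability (Omega' n) R)
  (Xs : forall n, nat -> {RV (P' n) >-> {set (V n)}})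
  (iidXs : forall n, iid_copies (X n) (Xs n))
  (C Tm Tp : nat -> R)
  (C_ge0 : forall n, 0 <= C n)
  (Tm_ge0 : forall n, 0 <= Tm n)
  (Tp_ge0 : forall n, 0 <= Tp n)
  (EZm : expected_uncovered (cover_prob (X n)) (Tm n) @[n --> \oo] --> +oo)
  (EZp : expected_uncovered (cover_prob (X n)) (Tp n) @[n --> \oo] --> (0 : R))
  (pairs : forall n (x y : V n), x != y ->
     cover_prob2 (X n) x y <=
       C n * (cover_prob (X n) x * cover_prob (X n) y))
  (smallq :
     (fun n => C n * mean_uncovered (cover_prob (X n)) (Tm n) : R^o)
       =o_\oo (fun n => (ln (n%:R : R))^-1 : R^o)) :
  P' n [set w | ((Tm n)%:E <= covering_time (Xs n) w)%E /\
                (covering_time (Xs n) w <= (Tp n)%:E)%E] @[n --> \oo] --> 1%E.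
Proof.
pose q n := cover_prob (X n).
pose Zm n := expected_uncovered (q n) (Tm n).
pose Zp n := expected_uncovered (q n) (Tp n).
pose good n := [set w | ((Tm n)%:E <= covering_time (Xs n) w)%E /\
                        (covering_time (Xs n) w <= (Tp n)%:E)%E].
suff h : forall eps : R, 0 < eps -> \forall n \near \oo,
    P' n (good n) \is a fin_num /\ 1 - eps <= fine (P' n (good n)) <= 1.
  apply/fine_cvgP; split.
    by have := h 1 ltr01; apply: filterS => n [].
  apply/cvgrPdist_le => eps /h; apply: filterS => n [_ /andP[lo hi]].
  by rewrite ger0_norm ?subr_ge0 //; move: lo; rewrite /=; lra.
(* The error is split into three parts of eps/3: e <= eps/60 handles 20 e, Zm >= 12/eps handles
   4/Zm, and Zp <= eps/(3 exp 1) handles the late term. *)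
move=> eps eps0; pose e := Num.min (1 / 8) (eps / 60).
have e0 : 0 < e by rewrite lt_min; apply/andP; split; lra.
have e8 : e <= 1 / 8 by rewrite ge_min lexx.
have e60 : e <= eps / 60 by rewrite ge_min lexx orbT.
have c0 : 0 < eps / (3 * expR 1) by rewrite divr_gt0 // mulr_gt0 ?expR_gt0.
have ee : 0 < e / 8 by lra.
have /cvgryPge /(_ (12 / eps)) Z1 := EZm.
have /cvgryPge /(_ (4 * (1 + 2 / e))) Z2 := EZm.
have /cvgrPdist_le /(_ _ c0) Z3 := EZp.
have /eqoP /(_ _ ee) Z4 := smallq.
near=> n.
(* From n = 2 on, ln n is positive, so the little-o bound can be multiplied through by it. *)
have n2 : (2 <= n)%N by near: n; exact: nbhs_infty_ge.
have Z1n : 12 / eps <= Zm n by near: n; exact: Z1.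
have Z2n : 4 * (1 + 2 / e) <= Zm n by near: n; exact: Z2.
have Z3n : `|0 - Zp n| <= eps / (3 * expR 1) by near: n; exact: Z3.
have Z4n : `|C n * mean_uncovered (q n) (Tm n)| <= e / 8 * `|(ln (n%:R : R))^-1|.
  by near: n; exact: Z4.
have ln0 : 0 < ln (n%:R : R) by rewrite ln_gt0 // ltr1n.
have small : C n * mean_uncovered (q n) (Tm n) * ln #|V n|%:R <= e / 8.
  rewrite cardV -ler_pdivlMr //; apply: le_trans (ler_norm _) (le_trans Z4n _).
  by rewrite gtr0_norm ?invr_gt0.
have Vn0 : (0 < #|V n|)%N by rewrite cardV; apply: leq_trans n2.
have e01 : 0 < e <= 1 / 8 by rewrite e0.
have large : 1 + 2 / e <= Zm n / 4 by lra.
have [fin /andP[lo hi]] := cover_between_ge (iidXs n) (C n) (Tm n) (Tp n) e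
  Vn0 (C_ge0 n) (Tm_ge0 n) (Tp_ge0 n) (pairs n) e01 small large.
split=> //; rewrite hi andbT; apply: le_trans lo; rewrite lerD2l lerN2.
rewrite -/(q n) -/(Zm n) -/(Zp n).
have Zm0 : 0 < Zm n by apply: lt_le_trans Z1n; rewrite divr_gt0.
have b1 : 4 / Zm n <= eps / 3.
  by move: Z1n; rewrite ler_pdivrMr // ler_pdivrMr //; lra.
have b2 : expR 1 * Zp n <= eps / 3.
  have : Zp n <= eps / (3 * expR 1).
    by apply: le_trans Z3n; rewrite sub0r normrN ler_norm.
  rewrite ler_pdivlMr ?mulr_gt0 ?expR_gt0 //; lra.
lra.
Unshelve. all: by end_near.
Qed.
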